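(* Let $Z\subset C'\subset P$ be subschemes of the plane $H=\{x=0\}$ with $Z$ nonempty zero-dimensional, $I_{C'}=(x,p)$, $I_P=(x,ph)$, $p,h\in S$ nonzero homogeneous, $\delta=\deg p$, $d=2\delta+\deg h$. Let $A\in S^{s,s+1}$ be a Hilbert–Burch matrix of $Z$, with minimal free resolution $0\to\overline G\xrightarrow{{}^tA}\overline F\to I_{Z,H}\to0$ over $S$ ($\overline G$ of rank $s$, $\overline F$ of rank $s+1$), and put $F=\overline F\otimes_SR$, $G=\overline G\otimes_SR$. Let $$J=(x^2,\ xp,\ phA_i+xB_i\mid 1\le i\le s+1)\subseteq R,$$ where $B=\begin{bmatrix} A & {}^t(f_1,\dots,f_s)\\ p_1\ \cdots\ p_{s+1} & f_{s+1}\end{bmatrix}\in S^{s+1,s+2}$ is homogeneous with $p=(-1)^sB_{s+2}$, and assume $J$ has the expected residual sequence $0\to I_{C'}(-1)\xrightarrow{\cdot x}J\to ph\,I_{Z,H}\to0$. Let $M\in S^{s,s+2}$ be $B$ with its last row deleted. Then $J$ has the graded minimal free resolution $$0\to G(-d-1+\delta)\xrightarrow{\alpha_3}G(-d+\delta)\oplus F(-d-1+\delta)\oplus R(-2-\delta)\xrightarrow{\alpha_2}R(-2)\oplus F(-d+\delta)\oplus R(-1-\delta)\xrightarrow{\alpha_1}J\to0,$$ where: $\alpha_1=\big[x^2,\ phA_1+xB_1,\ \dots,\ (-1)^{i+1}(phA_i+xB_i),\ \dots,\ (-1)^s(phA_{s+1}+xB_{s+1}),\ -px\big]$ (a $1\times(s+3)$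 matrix); $\alpha_2$ is the $(s+3)\times(2s+2)$ matrix whose first $s$ columns form the block $\begin{bmatrix}0\\ {}^tM\end{bmatrix}$ (a zero row above the $(s+2)\times s$ matrix ${}^tM$), whose next $s+1$ columns are $\begin{bmatrix}-B_1 & \cdots & (-1)^iB_i & \cdots & (-1)^{s+1}B_{s+1}\\ & & xE_{s+1} & & \\ A_1h & \cdots & (-1)^{i+1}A_ih & \cdots & (-1)^sA_{s+1}h\end{bmatrix}$, and whose last column is ${}^t(p,0,\dots,0,x)$; $\alpha_3=\begin{bmatrix}-xE_s\\ {}^tM\end{bmatrix}$ (a $(2s+2)\times s$ matrix).
   Context: $K$ is an algebraically closed field, $R=K[x,y,z,t]$, $S=K[y,z,t]$ identified with $R/xR$, $H$ the plane with ideal $xR$, $I_{Z,H}\subset S$ the saturated ideal of $Z$ in $H$. $E_t$ denotes the $t\times t$ identity matrix. For a $u\times(u+1)$ matrix $N$, $N_i$ is the determinant of the matrix obtained by deleting its $i$-th column. A matrix is homogeneous if it represents a degree-preserving map of graded free modules.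
   Formalization: It is also assumed that each B_i (1 ≤ i ≤ s+1) is homogeneous of the degree making phA_i + xB_i homogeneous; without this B can be homogeneous in other degrees and α_1 is not degree-preserving. *)

(* Defs.v *)
From HB Require Import structures.
From mathcomp Require Import all_boot all_order all_algebra.
From mathcomp Require Export mpoly.
Set Implicit Arguments. Unset Strict Implicit. Unset Printing Implicit Defensive.
Import Order.TTheory GRing.Theory Num.Theory.
Local Open Scope ring_scope.

Section Defs.
Variable K : closedFieldType.

(* R = K[x,y,z,t] with x = 'X_0, y = 'X_1, z = 'X_2, t = 'X_3 ;
   S = K[y,z,t] with y = 'X_0, z = 'X_1, t = 'X_2.                 *)
Definition Rg := {mpoly K[4]}.
Definition Sg := {mpoly K[3]}.
Definition xR : Rg := 'X_(@ord0 3).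

Definition incS (f : Sg) : Rg := mmap (@mpolyC 4 K) (fun i : 'I_3 => 'X_(lift ord0 i)) f.
Definition piS (f : Rg) : Sg :=
  mmap (@mpolyC 3 K) (fun i : 'I_4 => if unlift ord0 i is Some j then 'X_j else 0) f.

(* f is homogeneous of degree dg : int (zero is homogeneous of every degree;
   a nonzero homogeneous element has degree >= 0) *)
Definition hdeg {n} (dg : int) (f : {mpoly K[n]}) : Prop :=
  if (0 <= dg)%R then f \is (`|dg|%N).-homog else f == 0.

(* a matrix N : 'M_(r, c), read as the map of graded free modules
   (+)_j R(-src j) -> (+)_i R(-tgt i) acting on column vectors,
   is homogeneous (degree preserving). *)
Definition homog_mx {n r c} (src : 'I_c -> int) (tgt : 'I_r -> int)
  (N : 'M[{mpoly K[n]}]_(r, c)) : Prop :=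
  forall i j, hdeg (src j - tgt i) (N i j).

Definition in_maxideal {n} (f : {mpoly K[n]}) : Prop := f@_0%MM = 0.
Definition mx_in_maxideal {n r c} (N : 'M[{mpoly K[n]}]_(r, c)) : Prop :=
  forall i j, in_maxideal (N i j).

Definition minor {T : comRingType} {u} (N : 'M[T]_(u, u.+1)) (i : 'I_u.+1) : T :=
  \det (col' i N).

Definition ideal_gen {T : comRingType} {n} (g : 'I_n -> T) : T -> Prop :=
  fun f => exists c : 'I_n -> T, f = \sum_(i < n) c i * g i.

Definition hcomp {n} (k : nat) (f : {mpoly K[n]}) : {mpoly K[n]} :=
  \sum_(m <- msupp f | mdeg m == k) f@_m *: 'X_[m].

Definition homog_ideal {n} (I : {mpoly K[n]} -> Prop) : Prop :=
  forall f, I f -> forall k, I (hcomp k f).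

(* I = I : m^infty, m = ('X_0,...,'X_(n-1)); m^k = polynomials all of whose
   monomials have degree >= k *)
Definition saturated {n} (I : {mpoly K[n]} -> Prop) : Prop :=
  forall f, (exists k, forall g : {mpoly K[n]},
               (forall m, m \in msupp g -> (k <= mdeg m)%N) -> I (f * g)) -> I f.

(* the projective zero locus V(I) in P^2 is a finite nonempty set of points *)
Definition common_zero (I : Sg -> Prop) (v : 'rV[K]_3) : Prop :=
  v != 0 /\ forall f, I f -> f.@[fun i => v 0 i] = 0.
Definition zero_dim_nonempty (I : Sg -> Prop) : Prop :=
  (exists v, common_zero I v) /\
  (exists L : seq 'rV[K]_3, forall v, common_zero I v ->
      exists2 w, w \in L & exists c : K, v = c *: w).

End Defs.

(* The data of Theorem 3.7.  Indices are 0-based: the paper's A_i, B_i,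
   1 <= i <= s+1, are minor A (i-1), minor B (i-1) here, so the paper's sign
   (-1)^(i+1) becomes (-1)^i.                                              *)
Section Resolution.
Variables (K : closedFieldType) (s : nat) (p h : Sg K)
          (A : 'M[Sg K]_(s, s.+1)) (B : 'M[Sg K]_(s.+1, s.+2)).

Local Notation x := (xR K).
Local Notation incS := (@incS K).

Definition Bm (i : 'I_s.+1) : Sg K := minor B (widen_ord (leqnSn s.+1) i).

Definition Mmx : 'M[Sg K]_(s, s.+2) := row' ord_max B.

Definition Jideal : Rg K -> Prop := fun f =>
  exists (c0 c1 : Rg K) (c : 'I_s.+1 -> Rg K),
    f = c0 * x ^+ 2 + c1 * (x * incS p)
        + \sum_(i < s.+1) c i * (incS (p * h * minor A i) + x * incS (Bm i)).

Definition alpha1 : 'M[Rg K]_(1, (1 + s.+1) + 1) :=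
  row_mx (row_mx (const_mx (x ^+ 2))
                 (\row_(i < s.+1) ((-1) ^+ i * (incS (p * h * minor A i) + x * incS (Bm i)))))
         (const_mx (- (incS p * x))).

Definition tMtop : 'M[Rg K]_(s.+1, s) :=
  \matrix_(j < s.+1, k < s) incS (Mmx k (widen_ord (leqnSn s.+1) j)).
Definition tMbot : 'M[Rg K]_(1, s) := \matrix_(j < 1, k < s) incS (Mmx k ord_max).

Definition alpha2 : 'M[Rg K]_((1 + s.+1) + 1, (s + s.+1) + 1) :=
  row_mx
    (row_mx
       (col_mx (col_mx 0 tMtop) tMbot)
       (col_mx (col_mx (\row_(i < s.+1) ((-1) ^+ i.+1 * incS (Bm i)))
                       (x%:M))
               (\row_(i < s.+1) ((-1) ^+ i * incS (minor A i * h)))))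
    (col_mx (col_mx (const_mx (incS p)) 0) (const_mx x)).

Definition alpha3 : 'M[Rg K]_((s + s.+1) + 1, s) :=
  col_mx (col_mx (- (x%:M)) tMtop) tMbot.

(* degree shifts: a free module (+)_j R(-sh j) is encoded by sh.
   F = (+)_j R(-a j), G = (+)_k R(-b k), d = 2 delta + deg h. *)
Variables (a : 'I_s.+1 -> int) (b : 'I_s -> int) (delta d : int).

Definition sh0 : 'I_((1 + s.+1) + 1) -> int := fun j =>
  (row_mx (row_mx (const_mx 2) (\row_(i < s.+1) (a i + d - delta)))
          (const_mx (1 + delta)) : 'rV[int]_((1 + s.+1) + 1)) 0 j.
Definition sh1 : 'I_((s + s.+1) + 1) -> int := fun j =>
  (row_mx (row_mx (\row_(k < s) (b k + d - delta))
                  (\row_(i < s.+1) (a i + d + 1 - delta)))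
          (const_mx (2 + delta)) : 'rV[int]_((s + s.+1) + 1)) 0 j.
Definition sh2 : 'I_s -> int := fun k => b k + d + 1 - delta.

End Resolution.

(* Main.v *)
(** Expanding the determinant of [B] with row [k] repeated gives
    [sum_i (-1)^i A_ki B_i = p f_k]; together with [eps A^T = 0] this makes the
    sequence a complex.  Exactness is checked modulo [x]: a syzygy of the
    generators of [J] reduces to [p h eps v = 0], hence lies in the image of
    [A^T] modulo [x], and what remains is a syzygy of [x^2] and [p x]; a syzygy
    in the next step reduces to the kernel of [A^T], which is zero.  The degree
    [b_k + e - 1] of [f_k] is read off [p f_k].  Minimality holds because
    [Z] is nonempty, so that [delta] and the [a_i] are positive and [b_k > 1]. *)

Require Import Defs.
From HB Require Import structures.
From mathcomp Require Import all_boot all_order all_algebra.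
From mathcomp Require Import mpoly.
From mathcomp Require Import ring zify.
Set Implicit Arguments. Unset Strict Implicit. Unset Printing Implicit Defensive.
Import Order.TTheory GRing.Theory Num.Theory.
Local Open Scope ring_scope.

(** * The complex over an arbitrary domain, with its exactness modulo [x] as hypotheses *)

Section ResidualComplex.
Variables (R : idomainType) (n s : nat) (x P H : R).
Variables (ep bB : 'rV[R]_n) (T : 'M[R]_(n, s)) (t : 'rV[R]_s).

(** The maps [alpha1], [alpha2], [alpha3] in sign-free form: [ep] and [bB] stand for the signed
    minors of $A$ and $B$, [T] for the transpose of $A$, [t] for the entries $f_k$, and [P], [H] for
    $p$, $h$. *)
Definition res1 : 'rV[R]_((1 + n) + 1) :=
  row_mx (row_mx (x ^+ 2)%:M ((P * H) *: ep + x *: bB)) (- (P * x))%:M.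

Definition res2 : 'M[R]_((1 + n) + 1, (s + n) + 1) :=
  row_mx
    (row_mx (col_mx (col_mx 0 T) t) (col_mx (col_mx (- bB) x%:M) (H *: ep)))
    (col_mx (col_mx P%:M 0) x%:M).

Definition res3 : 'M[R]_((s + n) + 1, s) := col_mx (col_mx (- x%:M) T) t.

Hypothesis epT : ep *m T = 0.
Hypothesis bBT : bB *m T = P *: t.

Lemma res1_res2 : res1 *m res2 = 0.
Proof.
rewrite /res1 /res2 !mul_mx_row !mul_row_col mulmx0 !mulmxDl -!scalemxAl epT bBT.
rewrite !mul_scalar_mx !mul_mx_scalar scalerN !mulmx0 !scaler0 !add0r !scalerA.
rewrite !scale_scalar_mx -[RHS](row_mx0 _ _ (s + n) 1) -(row_mx0 _ _ s n).
by congr (row_mx (row_mx _ _) _); apply/matrixP=> i j; rewrite !mxE; ring.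
Qed.

Lemma res2_res3 : res2 *m res3 = 0.
Proof.
rewrite /res2 /res3 !mul_row_col !mul_col_mx !add_col_mx !mul0mx !mulNmx.
rewrite -!scalemxAl epT bBT !mulmxN !mul_scalar_mx !mul_mx_scalar.
rewrite -[RHS](col_mx0 _ (1 + n) 1) -(col_mx0 _ 1 n).
by congr (col_mx (col_mx _ _) _); apply/matrixP=> i j; rewrite !mxE; ring.
Qed.

Hypothesis x_neq0 : x != 0.
Hypothesis P_neq0 : P != 0.

Lemma res3_inj (u : 'cV_s) : res3 *m u = 0 -> u = 0.
Proof.
rewrite /res3 !mul_col_mx -(col_mx0 _ _ _ 1) -(col_mx0 _ s n).
case/eq_col_mx => /eq_col_mx[+ _] _; rewrite mulNmx mul_scalar_mx => /eqP.
by rewrite oppr_eq0 scalemx_eq0 (negPf x_neq0) => /eqP.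
Qed.

(** The premise says that [T] is injective modulo [x]. The middle rows read $Tu + xv = 0$, so $u =
    xu'$ and $v = -Tu'$ after cancelling [x]; the top row and [bBT] then give $q = -tu'$ after
    cancelling [P]. *)
Lemma res2_exact :
  (forall w c, T *m w = x *: c -> exists w', w = x *: w' :> 'cV_s) ->
  forall w : 'cV_((s + n) + 1), res2 *m w = 0 -> exists u, w = res3 *m u.
Proof.
move=> injT w; rewrite -[w]vsubmxK -[usubmx w]vsubmxK.
move: (usubmx (usubmx w)) (dsubmx (usubmx w)) (dsubmx w) => u v q.
rewrite /res2 !mul_row_col !mul_col_mx !add_col_mx !mul0mx add0r addr0.
rewrite -(col_mx0 _ _ _ 1) -(col_mx0 _ 1 n) => /eq_col_mx[/eq_col_mx[row0 mid] _].
rewrite mul_scalar_mx in mid.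
have [|u' def_u] := injT u (- v).
  by rewrite scalerN; apply/eqP; rewrite -addr_eq0 mid.
have def_v : v = - (T *m u').
  move: mid; rewrite def_u -scalemxAr -scalerDr => /eqP.
  rewrite scalemx_eq0 (negPf x_neq0) /= addrC addr_eq0 => /eqP ->; by [].
have def_q : q = - (t *m u').
  move: row0; rewrite def_v mulNmx mulmxN opprK mulmxA bBT -scalemxAl.
  rewrite mul_scalar_mx -scalerDr => /eqP.
  by rewrite scalemx_eq0 (negPf P_neq0) /= addrC addr_eq0 => /eqP.
(* The sign compensates the block $-x$ of [res3]. *)
exists (- u'); rewrite /res3 !mul_col_mx !mulmxN mulNmx opprK mul_scalar_mx.
by rewrite def_q def_v def_u.
Qed.

(** The premises say that [P] is regular modulo [x] and that, modulo [x], the kernel of $PH\cdot ep$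
    lies in the image of [T]. *)
Lemma res1_exact :
  (forall q c, P * q = x * c -> exists q', q = x * q') ->
  (forall v c, (P * H) *: (ep *m v) = x *: c ->
     exists w v', v = T *m w + x *: v' :> 'cV_n) ->
  forall v : 'cV_((1 + n) + 1), res1 *m v = 0 -> exists w, v = res2 *m w.
Proof.
move=> primeP syz v; rewrite -[v]vsubmxK -[usubmx v]vsubmxK.
move: (usubmx (usubmx v)) (dsubmx (usubmx v)) (dsubmx v) => v0 v1 v2 Ev.
(* The relation [Ev] rewrites as $PH\,ep\,v_1 = x(Pv_2 - xv_0 - bB\,v_1)$, which vanishes modulo
   [x]. *)
have [w [v' def_v1]] : exists w v', v1 = T *m w + x *: v'.
  apply: (syz _ (P *: v2 - (x *: v0 + bB *m v1))); move: Ev.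
  rewrite /res1 !mul_row_col mulmxDl -!scalemxAl !mul_scalar_mx => /eqP.
  rewrite scaleNr subr_eq0 addrCA => /eqP/(canRL (addrK _)) ->.
  by rewrite scalerBr scalerDr !scalerA expr2 [x * P]mulrC.
(* Subtract the image of (w, v', 0): what remains is a syzygy of x^2 and Px. *)
pose y := col_mx (col_mx w v') 0 : 'cV_((s + n) + 1).
have Ey : res2 *m y = col_mx (col_mx (- (bB *m v')) v1)
                             (t *m w + H *: (ep *m v')).
  rewrite /res2 /y !mul_row_col mulmx0 addr0 !mul_col_mx !add_col_mx mul0mx.
  by rewrite add0r mulNmx mul_scalar_mx -scalemxAl -def_v1.
pose z0 := v0 + bB *m v'; pose z2 := v2 - (t *m w + H *: (ep *m v')).
have Ez : col_mx (col_mx v0 v1) v2 = res2 *m y + col_mx (col_mx z0 0) z2.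
  rewrite Ey !add_col_mx addr0; congr (col_mx (col_mx _ _) _).
    by rewrite /z0 addrCA addNr addr0.
  by rewrite /z2 addrCA subrr addr0.
have xz : x * z0 0 0 = P * z2 0 0.
  move: Ev; rewrite Ez mulmxDr mulmxA res1_res2 mul0mx add0r.
  rewrite /res1 !mul_row_col mulmx0 addr0 !mul_scalar_mx scaleNr => /eqP.
  rewrite subr_eq0 => /eqP/matrixP/(_ 0 0); rewrite !mxE expr2 [P * x]mulrC -!mulrA.
  exact: mulfI.
(* Regularity of [P] gives $z_2 = xq$, then $z_0 = Pq$: the remainder is [q] times the last column
   of [res2]. *)
have [q z2E] := primeP _ _ (esym xz).
have z0E : z0 0 0 = P * q.
  by apply: (mulfI x_neq0); rewrite xz z2E mulrCA.
exists (y + col_mx 0 q%:M); rewrite Ez mulmxDr; congr (_ + _).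
rewrite /res2 mul_row_col mulmx0 add0r !mul_col_mx mul0mx -!scalar_mxM -z0E -z2E.
by rewrite -!mx11_scalar.
Qed.

End ResidualComplex.

(** * The ring maps between $S$ and $R$, and reduction modulo $x$ *)

Section ReductionModX.
Variable K : closedFieldType.
Local Notation x := (xR K).

HB.instance Definition _ :=
  GRing.isAdditive.Build (Sg K) (Rg K) (@incS K) (mmap_is_additive _ _).
HB.instance Definition _ :=
  GRing.isMultiplicative.Build (Sg K) (Rg K) (@incS K)
    (mmap_is_multiplicative _ (@mpolyC 4 K)).
HB.instance Definition _ :=
  GRing.isAdditive.Build (Rg K) (Sg K) (@piS K) (mmap_is_additive _ _).
HB.instance Definition _ :=
  GRing.isMultiplicative.Build (Rg K) (Sg K) (@piS K)
    (mmap_is_multiplicative _ (@mpolyC 3 K)).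

(** Suited to statements about ring morphisms such as [incS] and [piS], which need checking only on
    constants and variables. *)
Lemma mpoly_closed_ind (R : nzRingType) n (Q : {mpoly R[n]} -> Prop) :
  (forall c, Q c%:MP) -> (forall i, Q 'X_i) ->
  (forall f g, Q f -> Q g -> Q (f + g)) ->
  (forall f g, Q f -> Q g -> Q (f * g)) -> forall f, Q f.
Proof.
move=> QC QX QD QM; elim/mpolyind => [|c m f _ _ Qf]; first by rewrite -mpolyC0.
apply: QD Qf; rewrite -mul_mpolyC; apply: (QM) => //.
rewrite mpolyXE_id; elim/big_ind: _ => [||i _]; [by rewrite -mpolyC1 | exact: QM |].
by elim: (m i) => [|k IH]; rewrite ?expr0 -?mpolyC1 // exprS; apply: QM.
Qed.

Lemma incSC c : incS c%:MP = c%:MP :> Rg K.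
Proof. exact: mmapC. Qed.

Lemma incSX i : incS 'X_i = 'X_(lift ord0 i) :> Rg K.
Proof. by rewrite /incS mmapX mmap1U. Qed.

Lemma piSC c : piS c%:MP = c%:MP :> Sg K.
Proof. exact: mmapC. Qed.

Lemma piSX i : piS 'X_i = (if unlift ord0 i is Some j then 'X_j else 0) :> Sg K.
Proof. by rewrite /piS mmapX mmap1U. Qed.

Lemma piS_x : piS x = 0.
Proof. by rewrite piSX unlift_none. Qed.

Lemma incSK : cancel (@incS K) (@piS K).
Proof.
elim/mpoly_closed_ind => [c|i|f g Ef Eg|f g Ef Eg].
- by rewrite incSC piSC.
- by rewrite incSX piSX liftK.
- by rewrite !rmorphD /= Ef Eg.
- by rewrite !rmorphM /= Ef Eg.
Qed.

(** This makes the identification of $S$ with $R/xR$ effective: the kernel of [piS] is generated by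
    $x$. *)
Lemma piS_eq_mod_x (f : Rg K) : exists g, f = incS (piS f) + x * g.
Proof.
elim/mpoly_closed_ind: f => [c|i|f g [f' Ef] [g' Eg]|f g [f' Ef] [g' Eg]].
- by exists 0; rewrite piSC incSC mulr0 addr0.
- rewrite piSX; case: unliftP => [j ->|->].
    by exists 0; rewrite incSX mulr0 addr0.
  by exists 1; rewrite rmorph0 add0r mulr1.
- exists (f' + g'); rewrite !rmorphD /=.
  (* The reductions are generalized first, so that rewriting [f] and [g] leaves them untouched. *)
  by move: (incS (piS f)) (incS (piS g)) Ef Eg => f0 g0 -> ->; rewrite mulrDr addrACA.
- exists (f' * (incS (piS g) + x * g') + incS (piS f) * g'); rewrite !rmorphM /=.
  by move: (incS (piS f)) (incS (piS g)) Ef Eg => f0 g0 -> ->; ring.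
Qed.

Lemma x_neq0 : x != 0.
Proof.
apply/eqP => /(congr1 (mcoeff U_(ord0))) /eqP.
by rewrite mcoeffX eqxx mcoeff0 oner_eq0.
Qed.

Lemma piS_eq0 (f : Rg K) : piS f = 0 -> exists g, f = x * g.
Proof. by have [g Ef] := piS_eq_mod_x f => E0; exists g; rewrite Ef E0 rmorph0 add0r. Qed.

Lemma piS_mx_mod_x m n (M : 'M[Rg K]_(m, n)) :
  exists N, M = map_mx (@incS K) (map_mx (@piS K) M) + x *: N.
Proof.
have [g Eg] := fin_all_exists (fun ij : 'I_m * 'I_n => piS_eq_mod_x (M ij.1 ij.2)).
exists (\matrix_(i, j) g (i, j)); apply/matrixP=> i j.
by rewrite !mxE -(Eg (i, j)).
Qed.

Lemma incS_mcoeff0 (f : Sg K) : (incS f)@_0%MM = f@_0%MM.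
Proof.
elim/mpoly_closed_ind: f => [c|i|f g Ef Eg|f g Ef Eg].
- by rewrite incSC !mpolyCK.
- by rewrite incSX !mcoeffX !mnm1_eq0.
- by rewrite rmorphD !mcoeffD /= Ef Eg.
- by rewrite rmorphM !(rmorphM (mcoeff 0%MM)) /= Ef Eg.
Qed.

Lemma incS_homog k (f : Sg K) : f \is k.-homog -> incS f \is k.-homog.
Proof.
move=> /dhomogP hf; rewrite /incS /mmap big_seq; apply: rpred_sum => m /hf <-.
rewrite mul_mpolyC; apply: rpredZ; rewrite /mmap1 /= mdegE.
elim/big_rec2: _ => [|i f1 d1 _ IH]; first exact: dhomog1.
apply: dhomogM IH; rewrite -[X in X.-homog]mul1n; apply: dhomogMn.
by rewrite dhomogX /= mdeg1.
Qed.

End ReductionModX.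

(** * Homogeneity in integer degrees *)

Section IntegerDegrees.
Variables (K : closedFieldType) (n : nat).
Implicit Types (f g : {mpoly K[n]}) (d : int).

Lemma hdeg0 d : hdeg d (0 : {mpoly K[n]}).
Proof. by rewrite /hdeg; case: ifP => // _; apply: rpred0. Qed.

Lemma hdegD d f g : hdeg d f -> hdeg d g -> hdeg d (f + g).
Proof.
rewrite /hdeg; case: ifP => _; first exact: rpredD.
by move=> /eqP -> /eqP ->; rewrite addr0.
Qed.

Lemma hdeg_sum d (I : Type) (r : seq I) (F : I -> {mpoly K[n]}) :
  (forall i, hdeg d (F i)) -> hdeg d (\sum_(i <- r) F i).
Proof. by move=> hF; elim/big_ind: _ => // [|f g]; [apply: hdeg0 | apply: hdegD]. Qed.

Lemma hdeg_nat (k : nat) f : hdeg k f = (f \is k.-homog).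
Proof. by []. Qed.

Lemma hdegM d d' f g : hdeg d f -> hdeg d' g -> hdeg (d + d') (f * g).
Proof.
case: d => k; last by move/eqP->; rewrite mul0r => _; apply: hdeg0.
case: d' => l; last by move=> _ /eqP->; rewrite mulr0; apply: hdeg0.
exact: dhomogM.
Qed.

Lemma hdeg_sign d f k : hdeg d f -> hdeg d ((-1) ^+ k * f).
Proof.
move=> hf; rewrite -[d]add0r; apply: hdegM hf; rewrite hdeg_nat.
by rewrite -[X in X.-homog](mul0n k); apply: dhomogMn; rewrite rpredN dhomog1.
Qed.

Lemma hdegN d f : hdeg d f -> hdeg d (- f).
Proof. by move/(hdeg_sign 1); rewrite expr1 mulN1r. Qed.

Lemma hdeg_gt0_maxideal d f : 0 < d -> hdeg d f -> in_maxideal f.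
Proof.
case: d => // k k_gt0 hf; apply: (dhomog_nemf_coeff hf).
by rewrite /= mdeg0 eq_sym -lt0n.
Qed.

Lemma hdeg_le0 d f : d <= 0 -> hdeg d f -> f = (f@_0)%:MP.
Proof.
case: d => [[|k]|k] // _; last by move/eqP->; rewrite mcoeff0 mpolyC0.
move=> hf; apply/mpolyP => m; rewrite mcoeffC.
case: eqP => [->|/eqP m_neq0]; first by rewrite mulr1.
rewrite mulr0; apply: (dhomog_nemf_coeff hf).
by rewrite /= mdeg_eq0.
Qed.

(** Split [f] into homogeneous parts: the part of degree $i$ contributes to $fg$ in degree $i + k$
    only. *)
Lemma pihomogM_homog j k f g :
  g \is k.-homog -> pihomog mdeg (j + k) (f * g) = pihomog mdeg j f * g.
Proof.
move=> hg; rewrite {1}(pihomog_partitionE (leqnn (mmeasure mdeg f))) mulr_suml raddf_sum /=.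
rewrite [in RHS](pihomog_partitionE (leqnn (mmeasure mdeg f))) raddf_sum /= mulr_suml.
apply: eq_bigr => i _.
have [->|i_neq_j] := eqVneq (val i) j.
  rewrite pihomog_id pihomog_dE //; apply: dhomogM => //; exact: pihomogP.
rewrite (pihomog_ne0 i_neq_j (pihomogP _ _ _)) mul0r.
have ne : (i + k != j + k)%N by rewrite eqn_add2r.
by apply: (pihomog_ne0 ne); apply: dhomogM => //; apply: pihomogP.
Qed.

(** A part of [f] in a degree other than [d], multiplied by [g], is a part of $fg$ outside degree $d
    + k$; it vanishes, and [g] can be cancelled. *)
Lemma hdeg_divr d k f g :
  g != 0 -> g \is k.-homog -> hdeg (d + k%:Z) (f * g) -> hdeg d f.
Proof.
move=> g_neq0 hg hfg.
have piE j : j%:Z != d -> pihomog mdeg j f = 0.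
  move=> j_neq_d; apply: (mulIf g_neq0); rewrite mul0r -(pihomogM_homog _ _ hg).
  move: hfg; have : j%:Z + k%:Z != d + k%:Z by rewrite (inj_eq (addIr _)).
  case: (d + k%:Z) => l /=; last by move=> _ /eqP ->; rewrite raddf0.
  by move=> ne hl; apply: pihomog_ne0 hl; rewrite eq_sym.
case: d piE hfg => [l|l] piE _.
  rewrite hdeg_nat (pihomog_partitionE (leqnn (mmeasure mdeg f))).
  apply: rpred_sum => i _; have [->|ne] := eqVneq (val i) l; first exact: pihomogP.
  by rewrite piE ?rpred0.
rewrite /hdeg /= (pihomog_partitionE (leqnn (mmeasure mdeg f))) big1 // => i _.
exact: piE.
Qed.

End IntegerDegrees.

Lemma incS_hdeg (K : closedFieldType) d (f : Sg K) : hdeg d f -> hdeg d (incS f).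
Proof.
by case: d => k; [apply: incS_homog | move/eqP->; rewrite rmorph0; apply: hdeg0].
Qed.

(** Put a second copy of row [k] on top of [N]. The square matrix has two equal rows, and expanding
    its zero determinant along the top row gives the sum. *)
Lemma minor_row_syzygy (T : comNzRingType) u (N : 'M[T]_(u, u.+1)) (k : 'I_u) :
  \sum_(j < u.+1) (-1) ^+ j * N k j * minor N j = 0.
Proof.
pose N' : 'M[T]_u.+1 := \matrix_(i, j) N (odflt k (unlift ord0 i)) j.
have N'0 : \det N' = 0.
  apply: (@determinant_alternate _ _ _ ord0 (lift ord0 k)) => // j.
  by rewrite !mxE liftK unlift_none.
rewrite -[RHS]N'0 (expand_det_row _ ord0); apply: eq_bigr => j _.
rewrite !mxE unlift_none /= /cofactor mulrCA mulrA add0n; congr (_ * \det _).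
by apply/matrixP => i l; rewrite !mxE liftK.
Qed.

Lemma const_mx11 (T : nzRingType) (c : T) : const_mx c = c%:M :> 'M_1.
Proof. by apply/matrixP => i j; rewrite !ord1 !mxE. Qed.

(** * The maps of the theorem as instances of the abstract complex *)

Section Resolution.
Variables (K : closedFieldType) (s : nat) (p h : Sg K).
Variables (A : 'M[Sg K]_(s, s.+1)) (B : 'M[Sg K]_(s.+1, s.+2)).
Hypothesis BA : forall (k : 'I_s) (l : 'I_s.+1),
  B (widen_ord (leqnSn s) k) (widen_ord (leqnSn s.+1) l) = A k l.
Hypothesis pB : p = (-1) ^+ s * minor B ord_max.

Local Notation x := (xR K).
Local Notation iR := (@incS K).
Local Notation eps := (\row_(i < s.+1) ((-1) ^+ i * minor A i)).
Local Notation betaR := (\row_(i < s.+1) ((-1) ^+ i * iR (Bm B i))).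
Local Notation AR := (map_mx iR A^T).
Local Notation fR := (\row_(k < s) iR (Mmx B k ord_max)).

Lemma lift_max_widen m (k : 'I_m) : lift ord_max k = widen_ord (leqnSn m) k.
Proof. by apply: val_inj; rewrite /= /bump leqNgt ltn_ord. Qed.

Lemma tMtopE : tMtop B = AR.
Proof. by apply/matrixP => j k; rewrite !mxE lift_max_widen BA. Qed.

Lemma tMbotE : tMbot B = fR.
Proof. by apply/matrixP => j k; rewrite !mxE. Qed.

(** In the row syzygy of [B], the last term carries the sign $(-1)^{s+1}$; by [pB] it equals $-f_k
    p$ and moves to the other side. *)
Lemma last_columnE (k : 'I_s) :
  \sum_(i < s.+1) (-1) ^+ i * A k i * Bm B i = Mmx B k ord_max * p.
Proof.
have := minor_row_syzygy B (widen_ord (leqnSn s) k).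
rewrite big_ord_recr /= => /eqP; rewrite addr_eq0 => /eqP.
under eq_bigr do rewrite BA.
rewrite /Bm => ->; rewrite mxE lift_max_widen pB exprS mulN1r !mulNr opprK.
by rewrite mulrCA mulrA.
Qed.

Lemma betaR_AR : betaR *m AR = iR p *: fR.
Proof.
apply/rowP => k; rewrite mxE [RHS]mxE [X in _ * X]mxE [RHS]mulrC -rmorphM -last_columnE rmorph_sum.
by apply: eq_bigr => i _; rewrite !mxE !rmorphM rmorph_sign mulrAC.
Qed.

Lemma alpha1E : alpha1 p h A B = res1 x (iR p) (iR h) (map_mx iR eps) betaR.
Proof.
rewrite /alpha1 /res1 !const_mx11.
have -> // : \row_i ((-1) ^+ i * (iR (p * h * minor A i) + x * iR (Bm B i))) =
             (iR p * iR h) *: map_mx iR eps + x *: betaR.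
apply/matrixP => i j; rewrite !mxE !rmorphM rmorph_sign mulrDr mulrCA.
by congr (_ + _); rewrite mulrCA.
Qed.

Lemma alpha2E : alpha2 p h A B = res2 x (iR p) (iR h) (map_mx iR eps) betaR AR fR.
Proof.
rewrite /alpha2 /res2 tMtopE tMbotE !const_mx11.
have -> : \row_i ((-1) ^+ i.+1 * iR (Bm B i)) = - betaR.
  by apply/matrixP => i j; rewrite !mxE exprS mulN1r mulNr.
have -> // : \row_i ((-1) ^+ i * iR (minor A i * h)) = iR h *: map_mx iR eps.
by apply/matrixP => i j; rewrite !mxE !rmorphM rmorph_sign [RHS]mulrC mulrA.
Qed.

Lemma alpha3E : alpha3 B = res3 x AR fR.
Proof. by rewrite /alpha3 /res3 tMtopE tMbotE. Qed.

Lemma alpha1_mulE (v0 v2 : Rg K) (v1 : 'cV_s.+1) :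
  (alpha1 p h A B *m col_mx (col_mx v0%:M v1) v2%:M) 0 0 =
  v0 * x ^+ 2 - v2 * (x * iR p)
    + \sum_(i < s.+1) (-1) ^+ i * v1 i 0 * (iR (p * h * minor A i) + x * iR (Bm B i)).
Proof.
rewrite /alpha1 !mul_row_col !mul_mx_scalar !mxE addrAC; congr (_ + _ + _).
  by rewrite mulrN [iR p * x]mulrC.
by apply: eq_bigr => i _; rewrite !mxE mulrAC.
Qed.

Lemma Jideal_alpha1 f :
  Jideal p h A B f <-> exists v : 'cV_((1 + s.+1) + 1), f = (alpha1 p h A B *m v) 0 0.
Proof.
split=> [[c0 [c1 [c ->]]]|[v ->]].
  (* The entries of [alpha1] are the generators of $J$ up to sign, so the coefficients absorb the
     signs. *)
  exists (col_mx (col_mx c0%:M (\col_i ((-1) ^+ i * c i))) (- c1)%:M).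
  rewrite alpha1_mulE mulNr opprK; congr (_ + _).
  by apply: eq_bigr => i _; rewrite mxE signrMK.
rewrite -[v]vsubmxK -[usubmx v]vsubmxK.
move: (usubmx (usubmx v)) (dsubmx (usubmx v)) (dsubmx v) => v0 v1 v2.
rewrite [v0]mx11_scalar [v2]mx11_scalar alpha1_mulE.
move: (v0 0 0) (v2 0 0) => {}v0 {}v2.
by exists v0, (- v2), (fun i : 'I_s.+1 => (-1) ^+ i * v1 i 0); rewrite mulNr.
Qed.

(** * Exactness, by reduction to the resolution of $Z$ modulo $x$ *)

Section Exactness.
Hypothesis p_neq0 : p != 0.
Hypothesis h_neq0 : h != 0.
Hypothesis epsA : eps *m A^T = 0.
Hypothesis eps_exact :
  forall v : 'cV_s.+1, eps *m v = 0 -> exists w : 'cV_s, v = A^T *m w.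
Hypothesis A_inj : forall w : 'cV_s, A^T *m w = 0 -> w = 0.

Lemma epsAR : map_mx iR eps *m AR = 0.
Proof. by rewrite -map_mxM epsA map_mx0. Qed.

Lemma iR_neq0 f : f != 0 -> iR f != 0.
Proof. by rewrite -(inj_eq (can_inj (@incSK K))) rmorph0. Qed.

Lemma alpha1_alpha2 : alpha1 p h A B *m alpha2 p h A B = 0.
Proof. by rewrite alpha1E alpha2E res1_res2 // ?epsAR ?betaR_AR. Qed.

Lemma alpha2_alpha3 : alpha2 p h A B *m alpha3 B = 0.
Proof. by rewrite alpha2E alpha3E res2_res3 // ?epsAR ?betaR_AR. Qed.

Lemma alpha3_inj (u : 'cV_s) : alpha3 B *m u = 0 -> u = 0.
Proof. by rewrite alpha3E; apply: res3_inj; apply: x_neq0. Qed.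

Lemma piS_scale_x m n (M : 'M[Rg K]_(m, n)) : map_mx (@piS K) (x *: M) = 0.
Proof. by apply/matrixP => i j; rewrite !mxE rmorphM /= piS_x mul0r. Qed.

Lemma map_incSK m n (M : 'M[Sg K]_(m, n)) : map_mx (@piS K) (map_mx iR M) = M.
Proof. by apply/matrixP => i j; rewrite !mxE incSK. Qed.

Lemma alpha2_exact (w : 'cV_((s + s.+1) + 1)) :
  alpha2 p h A B *m w = 0 -> exists u, w = alpha3 B *m u.
Proof.
rewrite alpha2E alpha3E; apply: res2_exact.
- exact: betaR_AR.
- exact: x_neq0.
- exact: iR_neq0.
(* Modulo $x$ the relation becomes a kernel element of the transpose of $A$; it is zero, so [v] is
   divisible by $x$. *)
move=> v c /(congr1 (map_mx (@piS K))).
rewrite map_mxM map_incSK piS_scale_x => /A_inj v0.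
by have [v' ->] := piS_mx_mod_x v; exists v'; rewrite v0 map_mx0 add0r.
Qed.

Lemma alpha1_exact (v : 'cV_((1 + s.+1) + 1)) :
  alpha1 p h A B *m v = 0 -> exists w, v = alpha2 p h A B *m w.
Proof.
rewrite alpha1E alpha2E; apply: res1_exact.
- exact: epsAR.
- exact: betaR_AR.
- exact: x_neq0.
- move=> q c /(congr1 (@piS K)); rewrite !rmorphM /= incSK piS_x mul0r => /eqP.
  by rewrite mulf_eq0 (negPf p_neq0) => /eqP/piS_eq0.
(* Over the domain $S$ the factor $ph$ cancels, and the syzygy of [eps] lifts through
   [eps_exact]. *)
move=> {}v c /(congr1 (map_mx (@piS K))).
rewrite piS_scale_x map_mxZ map_mxM map_incSK rmorphM /= !incSK => /eqP.
rewrite scalemx_eq0 mulf_eq0 (negPf p_neq0) (negPf h_neq0) /= => /eqP.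
case/eps_exact => w Ew; have [v' Ev] := piS_mx_mod_x v.
by exists (map_mx iR w), v'; rewrite {1}Ev Ew map_mxM.
Qed.

End Exactness.

(** * Degrees of the entries *)

Section Degrees.
Variables (delta e : nat) (a : 'I_s.+1 -> int) (b : 'I_s -> int).
Hypothesis p_homog : p \is delta.-homog.
Hypothesis h_homog : h \is e.-homog.
Hypothesis A_homog : homog_mx b a A^T.
Hypothesis eps_homog : homog_mx a (fun _ => 0) eps.
Let d : int := (2 * delta + e)%N.
Hypothesis B_homog : forall i, hdeg (a i + d - delta%:Z - 1) (Bm B i).

Lemma x_hdeg : hdeg 1 x.
Proof. by rewrite hdeg_nat dhomogX /= mdeg1. Qed.

Lemma minor_hdeg i : hdeg (a i) (minor A i).
Proof.
have := eps_homog 0 i; rewrite subr0 mxE => /(hdeg_sign i).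
by rewrite signrMK.
Qed.

Lemma entry_hdeg k i : hdeg (b k - a i) (A k i).
Proof. by have := A_homog i k; rewrite mxE. Qed.

(** Here $d - \delta = \delta + e$ is the degree of $ph$, so $phA_i$ has degree $a_i + d - \delta$,
    and [B_homog] gives $xB_i$ the same degree. *)
Lemma alpha1_homog :
  homog_mx (sh0 a delta d) (fun _ => 0) (alpha1 p h A B).
Proof.
move=> i j; rewrite subr0 /sh0 /alpha1.
case: (split_ordP j) => [{}j|{}j] ->; rewrite ?row_mxEl ?row_mxEr; last first.
  rewrite !mxE; apply: hdegN; rewrite addrC.
  by apply: hdegM x_hdeg; apply: incS_hdeg.
case: (split_ordP j) => [{}j|{}j] ->; rewrite ?row_mxEl ?row_mxEr !mxE.
  by rewrite expr2; apply: (@hdegM _ _ 1 1) x_hdeg x_hdeg.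
apply: hdeg_sign; apply: hdegD; last first.
  have -> : a j + d - delta%:Z = 1 + (a j + d - delta%:Z - 1) by lia.
  by apply: hdegM x_hdeg _; apply: incS_hdeg.
have -> : a j + d - delta%:Z = (delta%:Z + e%:Z) + a j by rewrite /d; lia.
apply: incS_hdeg; apply: hdegM (minor_hdeg j); exact: hdegM.
Qed.

Hypothesis p_neq0 : p != 0.

(** Each term $A_{ki}B_i$ of $pf_k$ has degree $(b_k - a_i) + (a_i + d - \delta - 1) = b_k + e - 1 +
    \delta$; dividing by $p$ removes $\delta$. *)
Lemma last_column_hdeg k : hdeg (b k + e%:Z - 1) (Mmx B k ord_max).
Proof.
apply: (hdeg_divr p_neq0 p_homog); rewrite -last_columnE.
apply: hdeg_sum => i; rewrite -mulrA; apply: hdeg_sign.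
have -> : b k + e%:Z - 1 + delta%:Z = (b k - a i) + (a i + d - delta%:Z - 1).
  by rewrite /d; lia.
by apply: hdegM; [apply: entry_hdeg | apply: B_homog].
Qed.

Lemma scalar_x_hdeg n (c c' : 'I_n -> int) i j :
  (forall k, c k - c' k = 1) -> hdeg (c j - c' i) ((x%:M : 'M_n) i j).
Proof.
move=> cc'; rewrite mxE; case: eqP => [->|_]; last exact: hdeg0.
by rewrite cc'; apply: x_hdeg.
Qed.

Lemma alpha2_homog :
  homog_mx (sh1 a b delta d) (sh0 a delta d) (alpha2 p h A B).
Proof.
move=> i j; rewrite /sh0 /sh1 /alpha2.
case: (split_ordP j) => [{}j|{}j] ->; rewrite ?row_mxEl ?row_mxEr; last first.
  case: (split_ordP i) => [{}i|{}i] ->;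
    rewrite ?row_mxEl ?row_mxEr ?col_mxEu ?col_mxEd; last first.
    rewrite !mxE (_ : _ - _ = 1); [exact: x_hdeg | lia].
  case: (split_ordP i) => [{}i|{}i] ->;
    rewrite ?row_mxEl ?row_mxEr ?col_mxEu ?col_mxEd !mxE; last exact: hdeg0.
  by rewrite addrC addrA addNr add0r; apply: incS_hdeg.
(* Six blocks remain, each block column from top to bottom: zero, [tMtop], [tMbot] over $G$, then
   the $B_i$, $x$ times the identity and the $A_ih$ over $F$. *)
case: (split_ordP j) => [{}j|{}j] ->; rewrite ?row_mxEl ?row_mxEr;
  case: (split_ordP i) => [{}i|{}i] ->;
  rewrite ?row_mxEl ?row_mxEr ?col_mxEu ?col_mxEd;
  try (case: (split_ordP i) => [{}i|{}i] ->;
       rewrite ?row_mxEl ?row_mxEr ?col_mxEu ?col_mxEd).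
- by rewrite [X in hdeg _ X]mxE; exact: hdeg0.
- rewrite tMtopE !mxE (_ : _ - _ = b j - a i); last lia.
  by apply: incS_hdeg; apply: entry_hdeg.
- rewrite tMbotE [X in hdeg _ X]mxE [X in X - _]mxE [X in _ - X]mxE
    (_ : _ - _ = b j + e%:Z - 1); last first.
    by rewrite /d; lia.
  by apply: incS_hdeg; apply: last_column_hdeg.
- rewrite !mxE (_ : _ - _ = a j + d - delta%:Z - 1); last lia.
  by apply: hdeg_sign; apply: incS_hdeg.
- rewrite [X in X - _]mxE [X in _ - X]mxE.
  apply: (@scalar_x_hdeg _ (fun k => a k + d + 1 - delta%:Z)
                           (fun k => a k + d - delta%:Z)) => k; lia.
- rewrite !mxE (_ : _ - _ = a j + e%:Z); last by rewrite /d; lia.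
  by apply: hdeg_sign; apply: incS_hdeg; apply: hdegM (minor_hdeg j) _.
Qed.

Lemma alpha3_homog :
  homog_mx (sh2 b delta d) (sh1 a b delta d) (alpha3 B).
Proof.
move=> i j; rewrite /sh1 /sh2 /alpha3.
case: (split_ordP i) => [{}i|{}i] ->; rewrite ?row_mxEl ?row_mxEr ?col_mxEu ?col_mxEd.
  case: (split_ordP i) => [{}i|{}i] ->;
    rewrite ?row_mxEl ?row_mxEr ?col_mxEu ?col_mxEd.
    rewrite [X in hdeg _ X]mxE [X in _ - X]mxE; apply: hdegN.
    apply: (@scalar_x_hdeg _ (fun k => b k + d + 1 - delta%:Z)
                             (fun k => b k + d - delta%:Z)) => k; lia.
  rewrite tMtopE !mxE (_ : _ - _ = b j - a i); last lia.
  by apply: incS_hdeg; apply: entry_hdeg.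
rewrite tMbotE [X in hdeg _ X]mxE [X in _ - X]mxE
  (_ : _ - _ = b j + e%:Z - 1); last first.
  by rewrite /d; lia.
by apply: incS_hdeg; apply: last_column_hdeg.
Qed.

(** * Minimality: all entries lie in the maximal ideal *)

Hypothesis A_inj : forall w : 'cV_s, A^T *m w = 0 -> w = 0.
Hypothesis A_max : mx_in_maxideal A^T.
Hypothesis delta_gt0 : (0 < delta)%N.
Hypothesis a_gt0 : forall i, 0 < a i.

(** Injectivity makes row [k] of $A$ nonzero. A nonzero entry in the maximal ideal has positive
    degree $b_k - a_i$, and $a_i \ge 1$. Hence $b_k + e - 1 > 0$ even when $e = 0$, which puts $f_k$
    in the maximal ideal. *)
Lemma b_gt1 k : 1 < b k.
Proof.
have [i Aki] : exists i, A k i != 0.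
  apply/existsP; apply: contraT => /existsPn A0.
  have /A_inj/matrixP/(_ k 0) : A^T *m delta_mx k 0 = 0 :> 'cV_s.+1.
    rewrite -colE; apply/matrixP => i j; rewrite !mxE; apply/eqP.
    by rewrite -[_ == _]negbK A0.
  by rewrite !mxE !eqxx => /eqP; rewrite oner_eq0.
have : 0 < b k - a i.
  rewrite ltNge; apply: contra Aki => /hdeg_le0/(_ (entry_hdeg k i)) ->.
  by have := A_max i k; rewrite mxE /in_maxideal => ->; rewrite mpolyC0.
have := a_gt0 i; lia.
Qed.

Lemma incS_maxideal f : in_maxideal f -> in_maxideal (iR f).
Proof. by rewrite /in_maxideal incS_mcoeff0. Qed.

Lemma x_maxideal : in_maxideal x.
Proof. exact: hdeg_gt0_maxideal x_hdeg. Qed.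

Lemma in_maxideal0 n : in_maxideal (0 : {mpoly K[n]}).
Proof. exact: mcoeff0. Qed.

Lemma scalar_x_maxideal n : mx_in_maxideal (x%:M : 'M_n).
Proof.
by move=> i j; rewrite mxE; case: eqP => _; [apply: x_maxideal | apply: in_maxideal0].
Qed.

Lemma mx_in_maxideal_row n m m1 m2 (M1 : 'M[{mpoly K[n]}]_(m, m1)) (M2 : 'M_(m, m2)) :
  mx_in_maxideal M1 -> mx_in_maxideal M2 -> mx_in_maxideal (row_mx M1 M2).
Proof.
by move=> h1 h2 i j; case: (split_ordP j) => [{}j|{}j] ->; rewrite ?row_mxEl ?row_mxEr.
Qed.

Lemma mx_in_maxideal_col n m m1 m2 (M1 : 'M[{mpoly K[n]}]_(m1, m)) (M2 : 'M_(m2, m)) :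
  mx_in_maxideal M1 -> mx_in_maxideal M2 -> mx_in_maxideal (col_mx M1 M2).
Proof.
by move=> h1 h2 i j; case: (split_ordP i) => [{}i|{}i] ->; rewrite ?col_mxEu ?col_mxEd.
Qed.

Lemma tMtop_maxideal : mx_in_maxideal (tMtop B).
Proof. by rewrite tMtopE => i j; rewrite mxE; apply: incS_maxideal. Qed.

Lemma tMbot_maxideal : mx_in_maxideal (tMbot B).
Proof.
rewrite tMbotE => i k; rewrite mxE; apply: incS_maxideal.
by apply: hdeg_gt0_maxideal (last_column_hdeg k); have := b_gt1 k; lia.
Qed.

(** The entries of $A$ are covered by [A_max]. The $B_i$ have degree $a_i + \delta + e - 1$, the
    $A_ih$ degree $a_i + e$ and $p$ degree $\delta$, all positive. *)
Lemma alpha2_maxideal : mx_in_maxideal (alpha2 p h A B).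
Proof.
have mx0 m n : mx_in_maxideal (0 : 'M[Rg K]_(m, n)).
  by move=> i j; rewrite mxE; apply: in_maxideal0.
do ![apply: mx_in_maxideal_row | apply: mx_in_maxideal_col] => //.
- exact: tMtop_maxideal.
- exact: tMbot_maxideal.
- move=> i j; rewrite mxE; apply: hdeg_gt0_maxideal; last first.
    by apply: hdeg_sign; apply: incS_hdeg; apply: B_homog.
  by have := a_gt0 j; rewrite /d; lia.
- exact: scalar_x_maxideal.
- move=> i j; rewrite mxE; apply: (@hdeg_gt0_maxideal _ _ (a j + e%:Z)).
    by have := a_gt0 j; lia.
  by apply: hdeg_sign; apply: incS_hdeg; apply: hdegM (minor_hdeg j) _.
- move=> i j; rewrite mxE; apply: incS_maxideal.
  exact: (@hdeg_gt0_maxideal _ _ delta%:Z).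
- by move=> i j; rewrite mxE; apply: x_maxideal.
Qed.

Lemma alpha3_maxideal : mx_in_maxideal (alpha3 B).
Proof.
do ![apply: mx_in_maxideal_col].
- move=> i j; rewrite mxE /in_maxideal mcoeffN.
  by have := scalar_x_maxideal i j; rewrite /in_maxideal => ->; rewrite oppr0.
- exact: tMtop_maxideal.
- exact: tMbot_maxideal.
Qed.

End Degrees.

End Resolution.

(** * Positivity of the degrees from a point of $Z$, and the theorem *)

(** In degree at most 0 a nonzero polynomial is a nonzero constant, which has no zeros. *)
Lemma hdeg_gt0_of_zero (K : closedFieldType) n (v : 'I_n -> K) d (f : {mpoly K[n]}) :
  f != 0 -> hdeg d f -> f.@[v] = 0 -> 0 < d.
Proof.
move=> f_neq0 hf fv0; rewrite ltNge; apply: contra f_neq0 => /hdeg_le0/(_ hf) f_const.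
by move: fv0; rewrite f_const mevalC => ->; rewrite mpolyC0.
Qed.

Theorem theorem3p7
  (K : closedFieldType) (s : nat)
  (IZ : Sg K -> Prop)                     (* I_{Z,H} in S = K[y,z,t] *)
  (p h : Sg K) (delta e : nat)            (* delta = deg p, e = deg h *)
  (A : 'M[Sg K]_(s, s.+1)) (B : 'M[Sg K]_(s.+1, s.+2))
  (a : 'I_s.+1 -> int) (b : 'I_s -> int) (* Fbar = (+) S(-a j), Gbar = (+) S(-b k) *) :
  (* Z is a nonempty zero-dimensional subscheme of H with saturated ideal IZ *)
  homog_ideal IZ -> saturated IZ -> zero_dim_nonempty IZ ->
  (* p, h nonzero homogeneous; Z in C' (I_{C'} = (x,p) contained in I_Z) *)
  p != 0 -> p \is delta.-homog -> h != 0 -> h \is e.-homog -> IZ p ->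
  (* 0 -> Gbar --tA--> Fbar --eps--> I_{Z,H} -> 0 is a graded minimal free
     resolution, eps = [A_1, -A_2, ..., (-1)^s A_(s+1)] *)
  (let eps := \row_(i < s.+1) ((-1) ^+ i * minor A i) in
     (forall f, IZ f <-> exists v : 'cV_(s.+1), f = (eps *m v) 0 0)
  /\ eps *m A^T = 0
  /\ (forall v : 'cV_(s.+1), eps *m v = 0 -> exists w : 'cV_s, v = A^T *m w)
  /\ (forall w : 'cV_s, A^T *m w = 0 -> w = 0)
  /\ homog_mx b a A^T
  /\ homog_mx a (fun _ => 0) eps
  /\ mx_in_maxideal A^T) ->
  (* B = [A, t(f_1..f_s); p_1..p_(s+1), f_(s+1)] homogeneous, p = (-1)^s B_(s+2) *)
  (forall (k : 'I_s) (l : 'I_s.+1),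
      B (widen_ord (leqnSn s) k) (widen_ord (leqnSn s.+1) l) = A k l) ->
  p = (-1) ^+ s * minor B ord_max ->
  (exists (r : 'I_s.+1 -> int) (c : 'I_s.+2 -> int), homog_mx c r B) ->
  (* the generators phA_i + xB_i of J are homogeneous (J is a graded ideal) *)
  (forall i : 'I_s.+1,
      hdeg (a i + (2 * delta + e)%N%:Z - delta%:Z - 1) (Bm B i)) ->
  (* expected graded residual sequence 0 -> I_{C'}(-1) --x--> J -> ph I_{Z,H} -> 0 *)
  homog_ideal (Jideal p h A B) ->
  (forall f : Rg K, (Jideal p h A B f /\ exists g, f = xR K * g) <->
      exists u v : Rg K, f = xR K * (u * xR K + v * incS p)) ->
  (forall g : Sg K, (exists f, Jideal p h A B f /\ g = piS f) <->
      exists q, IZ q /\ g = p * h * q) ->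
  (* conclusion: graded minimal free resolution of J *)
  let d : int := (2 * delta + e)%N in
  let al1 := alpha1 p h A B in
  let al2 := alpha2 p h A B in
  let al3 := alpha3 B in
     (forall f, Jideal p h A B f <-> exists v : 'cV_((1 + s.+1) + 1), f = (al1 *m v) 0 0)
  /\ al1 *m al2 = 0
  /\ al2 *m al3 = 0
  /\ (forall v : 'cV_((1 + s.+1) + 1), al1 *m v = 0 -> exists w, v = al2 *m w)
  /\ (forall w : 'cV_((s + s.+1) + 1), al2 *m w = 0 -> exists u, w = al3 *m u)
  /\ (forall u : 'cV_s, al3 *m u = 0 -> u = 0)
  /\ homog_mx (sh0 a delta d) (fun _ => 0) al1
  /\ homog_mx (sh1 a b delta d) (sh0 a delta d) al2
  /\ homog_mx (sh2 b delta d) (sh1 a b delta d) al3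
  /\ mx_in_maxideal al2 /\ mx_in_maxideal al3.
Proof.
move=> _ _ [[v0 [_ v0_zero]] _] p_neq0 p_homog h_neq0 h_homog IZp.
move=> [IZ_eps [epsA [eps_exact [A_inj [A_homog [eps_homog A_max]]]]]] BA pB _.
move=> B_homog _ _ _ d al1 al2 al3.
have delta_gt0 : (0 < delta)%N.
  have := hdeg_gt0_of_zero (d := delta%:Z) p_neq0 p_homog (v0_zero _ IZp); lia.
(* If $A_i = 0$, the $i$-th basis vector is a syzygy of [eps], hence in the image of the transpose
   of $A$. Its coordinate 1 would then have zero constant term by [A_max]. *)
have minor_neq0 i : minor A i != 0.
  apply/eqP => Ai0.
  have /eps_exact[w /matrixP/(_ i 0)] :
      (\row_(i < s.+1) ((-1) ^+ i * minor A i)) *m delta_mx i (@ord0 0) = 0.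
    by rewrite -colE; apply/matrixP => j k; rewrite !mxE Ai0 mulr0.
  rewrite !mxE !eqxx => /(congr1 (mcoeff 0%MM)).
  rewrite mcoeff1 eqxx raddf_sum big1 => [/eqP|k _]; first by rewrite oner_eq0.
  rewrite /= (rmorphM (mcoeff 0%MM)) /=.
  by have := A_max i k; rewrite mxE /in_maxideal => ->; rewrite mul0r.
(* The nonzero minor $A_i$ lies in [IZ], so it vanishes at the point [v0] of $Z$. *)
have a_gt0 i : 0 < a i.
  apply: hdeg_gt0_of_zero (minor_neq0 i) (minor_hdeg eps_homog i) (v0_zero _ _).
  apply/IZ_eps; exists ((-1) ^+ i *: delta_mx i 0).
  by rewrite -scalemxAr -colE !mxE signrMK.
split; first exact: Jideal_alpha1.
split; first exact: alpha1_alpha2.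
split; first exact: alpha2_alpha3.
split; first exact: alpha1_exact.
split; first exact: alpha2_exact.
split; first exact: alpha3_inj.
split; first exact: (alpha1_homog p_homog h_homog eps_homog B_homog).
split.
  exact: (alpha2_homog BA pB p_homog h_homog A_homog eps_homog B_homog p_neq0).
split; first exact: (alpha3_homog BA pB p_homog h_homog A_homog B_homog p_neq0).
split; first exact: (alpha2_maxideal BA pB p_homog h_homog A_homog eps_homog B_homog).
exact: (alpha3_maxideal BA pB p_homog h_homog A_homog B_homog).
Qed.
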